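(* There exist infinite groups that are not LEF groups. In particular, the Thompson groups $T$ and $V$ are not LEF groups.
   Context: Let $A$ be a subset of a group $G$ and let $H$ be a group. A partial homomorphism from $A$ to $H$ is a function $f : A \to H$ such that, for all $a, b \in A$ with $ab \in A$, one has $f(ab) = f(a) f(b)$. A local embedding is a one-to-one partial homomorphism. A group $G$ is locally embeddable into finite groups, or an LEF group, if for every finite subset $A$ of $G$ there exist a finite group $H$ and a local embedding $f : A \to H$. The Thompson groups $T$ and $V$ are the standard ones. A dyadic rational is a number of the form $m/2^n$ with $m, n \in \mathbf{Z}$, $n \ge 0$. The group $V$ consists, under composition, of all bijections $g : [0,1) \to [0,1)$ for which there is a partition of $[0,1)$ into finitely many half-open intervals $[a,b)$ with dyadic rational endpoints such that on each of these intervals $g$ has the form $g(x) = 2^k x + d$ with $k \in \mathbf{Z}$ and $d$ a dyadic rational ($k$ and $d$ depending on the interval). The group $T$ is the subgroup of $V$ consisting of those $g$ that induce a homeomorphism of the circle $\mathbf{R}/\mathbf{Z}$, where $[0,1)$ is identified with $\mathbf{R}/\mathbf{Z}$ in the usual way. *)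

(* Defs.v *)
From HB Require Import structures.
From mathcomp Require Import all_boot all_order all_algebra all_fingroup.
From mathcomp Require Import generic_quotient.
From mathcomp Require Import all_classical all_reals topology.

Set Implicit Arguments.
Unset Strict Implicit.
Unset Printing Implicit Defensive.

Import Order.TTheory GRing.Theory Num.Theory.
Import numFieldTopology.Exports.

Local Open Scope classical_set_scope.
Local Open Scope quotient_scope.
Local Open Scope ring_scope.

(* Maps defined on a subset [A] are represented by total functions of which
   only the values on [A] are used. *)
Definition partial_homomorphism (G H : groupType) (A : set G) (f : G -> H) :
    Prop :=
  forall a b, A a -> A b -> A (a * b)%g -> f (a * b)%g = (f a * f b)%g.

Definition local_embedding (G H : groupType) (A : set G) (f : G -> H) : Prop :=
  partial_homomorphism A f /\ set_inj A f.

Definition LEF (G : groupType) : Prop :=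
  forall A : set G, finite_set A ->
  exists (H : finGroupType) (f : G -> H), local_embedding A f.

Record bijection (X : Type) := Bijection {
  bijection_fun :> X -> X;
  bijection_bij : bijective bijection_fun }.

HB.instance Definition _ (X : Type) := gen_eqMixin (bijection X).
HB.instance Definition _ (X : Type) := gen_choiceMixin (bijection X).

Section BijectionGroup.
Variable X : Type.
Implicit Types f g : bijection X.

Lemma bijection_eq f g : f =1 g -> f = g.
Proof.
case: f g => [f bf] [g bg] /= /funext fg.
by rewrite fg in bf *; congr Bijection; exact: Prop_irrelevance.
Qed.

Definition bijection_one : bijection X :=
  @Bijection X id (Bijective (frefl id) (frefl id)).

Definition bijection_mul f g : bijection X :=
  Bijection (bij_comp (bijection_bij f) (bijection_bij g)).

Lemma bijection_inv_subproof f :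
  {h : X -> X | cancel f h /\ cancel h f}.
Proof. by apply: cid; case: (bijection_bij f) => h fK hK; exists h. Qed.

Lemma bijection_inv_bij f : bijective (sval (bijection_inv_subproof f)).
Proof. by case: bijection_inv_subproof => h [fK hK]; exists f. Qed.

Definition bijection_inv f : bijection X := Bijection (bijection_inv_bij f).

Lemma bijection_funK f : cancel f (bijection_inv f).
Proof. exact: (svalP (bijection_inv_subproof f)).1. Qed.

Lemma bijection_invK f : cancel (bijection_inv f) f.
Proof. exact: (svalP (bijection_inv_subproof f)).2. Qed.

Lemma bijection_mulA : associative bijection_mul.
Proof. by move=> f g h; apply: bijection_eq. Qed.
Lemma bijection_1mul : left_id bijection_one bijection_mul.
Proof. by move=> f; apply: bijection_eq. Qed.
Lemma bijection_mul1 : right_id bijection_one bijection_mul.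
Proof. by move=> f; apply: bijection_eq. Qed.
Lemma bijection_mulV : left_inverse bijection_one bijection_inv bijection_mul.
Proof. by move=> f; apply: bijection_eq => x; exact: bijection_funK. Qed.
Lemma bijection_Vmul : right_inverse bijection_one bijection_inv bijection_mul.
Proof. by move=> f; apply: bijection_eq => x; exact: bijection_invK. Qed.

HB.instance Definition _ := isGroup.Build (bijection X) bijection_mulA
  bijection_1mul bijection_mul1 bijection_mulV bijection_Vmul.
End BijectionGroup.

Section Thompson.
Variable R : realType.

Definition Ico01 : Type := {x : R | x \in `[0, 1[}.
HB.instance Definition _ := SubChoice.copy Ico01 {x : R | x \in `[0, 1[}.

Definition dyadic (x : R) : Prop :=
  exists (m : int) (n : nat), x = m%:~R / 2 ^+ n.

Definition dyadic_affine_on (J : set R) (g : Ico01 -> Ico01) : Prop :=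
  exists (k : int) (d : R), dyadic d /\
    forall x : Ico01, J (val x) -> val (g x) = 2 ^ k * val x + d.

Definition piecewise_dyadic (g : Ico01 -> Ico01) : Prop :=
  exists (I : finType) (a b : I -> R),
  [/\ forall i, dyadic (a i) /\ dyadic (b i),
      partition [set: I] (fun i => `[a i, b i[%classic) `[0, 1[%classic &
      forall i, dyadic_affine_on `[a i, b i[%classic g].

Definition V_pred : {pred bijection Ico01} :=
  fun g => `[< piecewise_dyadic g >].

Lemma dyadic0 : dyadic 0.
Proof. by exists 0, 0%N; rewrite mul0r. Qed.

Lemma dyadic1 : dyadic 1.
Proof. by exists 1, 0%N; rewrite expr0 divr1. Qed.

Lemma dyadicD x y : dyadic x -> dyadic y -> dyadic (x + y).
Proof.
move=> [m [n ->]] [p [q ->]]; exists (m * 2 ^+ q + p * 2 ^+ n), (n + q)%N.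
rewrite exprD intrD !intrM !rmorphXn /=.
have h k : (2 : R) ^+ k != 0 by rewrite expf_neq0 ?pnatr_eq0.
by rewrite addf_div.
Qed.

Lemma dyadicN x : dyadic x -> dyadic (- x).
Proof. by move=> [m [n ->]]; exists (- m), n; rewrite rmorphN mulNr. Qed.

Lemma dyadicMz (k : int) x : dyadic x -> dyadic (2 ^ k * x).
Proof.
move=> [m [n ->]]; case: k => k.
  by exists (2 ^+ k * m), n; rewrite intrM rmorphXn /= -mulrA.
exists m, (n + k.+1)%N.
by rewrite NegzE exprD invfM [RHS]mulrA [RHS]mulrC.
Qed.

Lemma dyadic_max x y : dyadic x -> dyadic y -> dyadic (Num.max x y).
Proof. by rewrite /Num.max; case: ifP. Qed.

Lemma dyadic_min x y : dyadic x -> dyadic y -> dyadic (Num.min x y).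
Proof. by rewrite /Num.min; case: ifP. Qed.

Lemma exp2z_gt0 (k : int) : 0 < (2 : R) ^ k.
Proof. exact: exprz_gt0. Qed.

Lemma exp2zD (k l : int) : (2 : R) ^ (k + l) = 2 ^ k * 2 ^ l.
Proof. by rewrite expfzDr// pnatr_eq0. Qed.

Lemma piecewise_dyadicP (g : Ico01 -> Ico01) : piecewise_dyadic g <->
  exists (I : finType) (a b d : I -> R) (k : I -> int),
  [/\ forall i, [/\ dyadic (a i), dyadic (b i) & dyadic (d i)],
      forall x, x \in `[0, 1[ -> exists i, x \in `[a i, b i[,
      forall i x, x \in `[a i, b i[ -> x \in `[0, 1[,
      forall i j x, x \in `[a i, b i[ -> x \in `[a j, b j[ -> i = j &
      forall i x, val x \in `[a i, b i[ -> val (g x) = 2 ^ k i * val x + d i].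
Proof.
split=> [[I [a [b [dab [cov triv _]]]]] | [I [a [b [d [k]]]]]].
  move=> /choice[k] /choice[d] gE; exists I, a, b, d, k; split.
  - by move=> i; have [] := dab i; have [] := gE i.
  - by move=> x x01; have : `[0, 1[%classic x by []; rewrite -cov => -[i _]; exists i.
  - by move=> i x xi; have : cover [set: I] (fun i => `[a i, b i[%classic) x;
      [exists i | rewrite cov].
  - by move=> i j x xi xj; apply: triv => //; exists x.
  - by move=> i x xi; apply: (gE i).2.
move=> [dab cov sub triv gE].
exists {i : I | a i < b i}, (a \o val), (b \o val); split.
- by move=> i; have [] := dab (val i).
- split.
  + rewrite eqEsubset; split=> [x [i _] /sub//|x x01].
    have [i xi] := cov _ x01.
    have lt_ab : a i < b i.
      by move: xi; rewrite in_itv/= => /andP[]; exact: le_lt_trans.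
    by exists (exist _ i lt_ab).
  + by move=> i j _ _ [x [/= xi xj]]; apply: val_inj; exact: triv xi xj.
  + by move=> i _; exists (a (val i)); rewrite /= in_itv/= lexx/=; exact: (valP i).
- by move=> i; exists (k (val i)), (d (val i)); have [] := dab (val i);
    split=> // x xi; exact: gE.
Qed.

Lemma piecewise_dyadic1 : piecewise_dyadic id.
Proof.
apply/piecewise_dyadicP.
exists unit, (fun=> 0), (fun=> 1), (fun=> 0), (fun=> 0); split=> //.
- by move=> _; split; [exact: dyadic0|exact: dyadic1|exact: dyadic0].
- by move=> [] [].
- by move=> _ x _; rewrite expr0z mul1r addr0.
Qed.

Lemma piecewise_dyadic_comp (g f : Ico01 -> Ico01) :
  piecewise_dyadic g -> piecewise_dyadic f -> piecewise_dyadic (g \o f).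
Proof.
move=> /piecewise_dyadicP[J [c [e [h [l [dJ covJ subJ trivJ gE]]]]]].
move=> /piecewise_dyadicP[I [a [b [d [k [dI covI subI trivI fE]]]]]].
apply/piecewise_dyadicP; exists (I * J)%type.
pose s i y := 2 ^ (- k i) * (y - d i).
exists (fun p => Num.max (a p.1) (s p.1 (c p.2))).
exists (fun p => Num.min (b p.1) (s p.1 (e p.2))).
exists (fun p => 2 ^ (l p.2) * d p.1 + h p.2), (fun p => l p.2 + k p.1).
have sK i y : 2 ^ k i * s i y + d i = y.
  by rewrite mulrA -exp2zD subrr expr0z mul1r subrK.
have s_le i x y : (s i y <= x) = (y <= 2 ^ k i * x + d i).
  by rewrite -[in RHS](sK i y) lerD2r ler_pM2l// exp2z_gt0.
have s_lt i x y : (x < s i y) = (2 ^ k i * x + d i < y).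
  by rewrite -[in RHS](sK i y) ltrD2r ltr_pM2l// exp2z_gt0.
have inE p x : x \in `[Num.max (a p.1) (s p.1 (c p.2)),
                       Num.min (b p.1) (s p.1 (e p.2))[ =
    (x \in `[a p.1, b p.1[) && (2 ^ k p.1 * x + d p.1 \in `[c p.2, e p.2[).
  by rewrite !in_itv/= ge_max lt_min s_le s_lt andbACA.
split=> [p|x x01|p x|p q x|p x].
- have [da db dd] := dI p.1; have [dc de dh] := dJ p.2.
  split; [apply: dyadic_max => //|apply: dyadic_min => //|];
    do ?[exact/dyadicMz/dyadicD/dyadicN].
  exact/dyadicD/dh/dyadicMz.
- have [i xi] := covI _ x01.
  have [j yj] := covJ _ (valP (f (Sub x x01))).
  by exists (i, j); rewrite inE/= xi/= -(fE i (Sub x x01)).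
- by rewrite inE => /andP[/subI].
- rewrite !inE => /andP[xi yj] /andP[xi'].
  have /= pq1 := trivI _ _ _ xi xi'; rewrite -pq1 => /(trivJ _ _ _ yj).
  by case: p q pq1 {xi yj xi'} => ? ? [? ?] /= -> ->.
- rewrite inE => /andP[xi]; rewrite -(fE _ _ xi) => /gE /= ->.
  by rewrite (fE _ _ xi) mulrDr mulrA -exp2zD addrA.
Qed.

Lemma piecewise_dyadicV (f : bijection Ico01) :
  piecewise_dyadic f -> piecewise_dyadic (f^-1)%g.
Proof.
move=> /piecewise_dyadicP[I [a [b [d [k [dI covI subI trivI fE]]]]]].
apply/piecewise_dyadicP; exists I.
pose s i x := 2 ^ k i * x + d i; pose t i y := 2 ^ (- k i) * (y - d i).
have tK i y : s i (t i y) = y.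
  by rewrite /s mulrA -exp2zD subrr expr0z mul1r subrK.
have inE i y : y \in `[s i (a i), s i (b i)[ = (t i y \in `[a i, b i[).
  rewrite !in_itv/= -[in LHS](tK i y) /s lerD2r ltrD2r.
  by rewrite ler_pM2l ?exp2z_gt0// ltr_pM2l// exp2z_gt0.
have fs i y : t i y \in `[a i, b i[ ->
    {x : Ico01 | val x = t i y & val (f x) = y}.
  move=> yi; exists (Sub (t i y) (subI _ _ yi)) => //.
  by rewrite (fE i) //= -/(s i _) tK.
exists (fun i => s i (a i)), (fun i => s i (b i)).
exists (fun i => - (2 ^ (- k i) * d i)), (fun i => - k i).
split=> [i|y y01|i y|i j y|i y].
- have [da db dd] := dI i; split; do ?[exact/dyadicD/dd/dyadicMz].
  exact/dyadicN/dyadicMz.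
- have [x xy] : exists x, f x = Sub y y01.
    by exists ((f^-1)%g (Sub y y01)); exact: bijection_invK.
  have [i xi] := covI _ (valP x); exists i; rewrite inE.
  suff -> : t i y = val x by [].
  have <- : val (f x) = y by rewrite xy.
  rewrite (fE _ _ xi).
  by rewrite /t addrK mulrA -exp2zD addNr expr0z mul1r.
- by rewrite inE => /fs[x _ <-]; exact: valP.
- rewrite !inE => yi yj; have [x xi fx] := fs _ _ yi.
  have [x' xj fx'] := fs _ _ yj.
  have xx' : x = x'.
    by apply: (bij_inj (bijection_bij f)); apply: val_inj; rewrite fx fx'.
  by apply: (trivI i j (val x)); [rewrite xi|rewrite xx' xj].
- rewrite inE => /fs[x xi fx].
  have -> : y = f x by exact/val_inj.
  by rewrite [LHS](congr1 val (bijection_funK f x)) xi -fx /t mulrBr.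
Qed.

Lemma V_group_closed : group_closed V_pred.
Proof.
split=> [|f g /asboolP Vf /asboolP Vg]; first exact/asboolP/piecewise_dyadic1.
exact/asboolP/(piecewise_dyadic_comp Vf)/piecewise_dyadicV.
Qed.

Definition thompsonV : Type := {g : bijection Ico01 | g \in V_pred}.
HB.instance Definition _ :=
  SubChoice.copy thompsonV {g : bijection Ico01 | g \in V_pred}.
HB.instance Definition _ :=
  SubChoice_isSubGroup.Build _ _ thompsonV V_group_closed.

Definition congr_int (x y : R) : bool := x - y \is a Num.int.

Lemma congr_int_equiv : equiv_class_of congr_int.
Proof.
split=> [x|x y|y x z]; rewrite /congr_int ?subrr ?rpred0//.
  by rewrite -opprB rpredN.
by move=> xy yz; rewrite -(subrKA y) rpredD.
Qed.

Canonical congr_int_equiv_rel := EquivRelPack congr_int_equiv.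
Canonical congr_int_enc := defaultEncModRel congr_int.

Definition circle : Type := quotient_topology {eq_quot congr_int}.
HB.instance Definition _ :=
  Topological.copy circle (quotient_topology {eq_quot congr_int}).

Definition to_circle (x : Ico01) : circle :=
  (\pi_(quotient_topology {eq_quot congr_int}) (val x))%qT.

Definition homeomorphism (X Y : topologicalType) (h : X -> Y) : Prop :=
  continuous h /\
  exists h' : Y -> X, [/\ continuous h', cancel h h' & cancel h' h].

Definition induces_circle_homeomorphism (g : Ico01 -> Ico01) : Prop :=
  exists h : circle -> circle, homeomorphism h /\
    forall x, h (to_circle x) = to_circle (g x).

Definition T_pred : {pred thompsonV} :=
  fun g => `[< induces_circle_homeomorphism (val g) >].

Lemma T_group_closed : group_closed T_pred.
Proof.
split=> [|f g /asboolP[hf [[cf [hf' [cf' fK f'K]]] fE]]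
              /asboolP[hg [[cg [hg' [cg' gK g'K]]] gE]]]; apply/asboolP.
  exists id; split; last by [].
  by split=> [x|]; [exact: cvg_id | exists id; split=> // x; exact: cvg_id].
exists (hf \o hg'); split; first split.
- by move=> x; apply: continuous_comp; [exact: cg'|exact: cf].
- exists (hg \o hf'); split; [|exact: can_comp|exact: can_comp].
  by move=> x; apply: continuous_comp; [exact: cf'|exact: cg].
move=> x /=; rewrite -fE; congr hf.
by rewrite -[x in LHS](bijection_invK (val g)) -gE gK.
Qed.

Definition thompsonT : Type := {g : thompsonV | g \in T_pred}.
HB.instance Definition _ :=
  SubChoice.copy thompsonT {g : thompsonV | g \in T_pred}.
HB.instance Definition _ :=
  SubChoice_isSubGroup.Build _ _ thompsonT T_group_closed.
End Thompson.

(* Main.v *)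
(* Thompson's group F, the increasing elements of T, is finitely presented and
   its finite quotients are abelian.  Concretely, put x_k = c^-k b c^k where c and b
   are the usual generators of F.  The two relations
   b^-1 x_k b = x_(k+1), k = 1, 2, imply the same relation for all k >= 1.  If c
   has finite order N, then taking k = N gives x_(N+1) = x_N = b, that is
   c^-1 b c = b.  A local embedding into a finite group preserves the two
   relations, so it cannot separate b from c^-1 b c, which differ in F.  The
   same argument shows that c has infinite order. *)
Require Import Defs.
From mathcomp Require Import all_boot all_order all_algebra all_fingroup.
From mathcomp Require Import all_classical all_reals topology.
From mathcomp Require Import generic_quotient ring lra normedtype Rstruct.

Set Implicit Arguments.
Unset Strict Implicit.
Unset Printing Implicit Defensive.

Import Order.TTheory GRing.Theory Num.Theory.
Import numFieldNormedType.Exports.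

(** * Group theory: two conjugation relations that obstruct LEF *)

Section Groups.
Local Open Scope group_scope.

Lemma conjg_fixed_of_finite_order (G : groupType) (b c : G) n :
  (b ^ c) ^ b = b ^ (c ^+ 2) -> (b ^ (c ^+ 2)) ^ b = b ^ (c ^+ 3) ->
  c ^+ n.+1 = 1 -> b ^ c = b.
Proof.
move=> bcb bc2b cn1; pose x k := b ^ (c ^+ k).
have xD k l : x (k + l) = x k ^ (c ^+ l) by rewrite /x expgnDr conjgM.
have x0 : x 0 = b by rewrite /x conjg1.
(* Conjugating a relation by [c ^+ l] raises every index in it by [l]. *)
have shift i k l : x i ^ x k = x i.+1 -> x (i + l) ^ x (k + l) = x (i + l).+1.
  by rewrite -addSn !xD -conjJg => ->.
(* Two consecutive relations are carried along, since each new one is deduced from the previous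
   two. *)
have xb k : x k.+1 ^ x 0 = x k.+2 /\ x k.+2 ^ x 0 = x k.+3.
  elim: k => [|k [xk xk1]]; first by rewrite x0; split.
  (* [x_(k+3)] is the conjugate of [x_(k+2)] by [x_1]; conjugate it by [x_0]. *)
  split=> //; have := shift _ _ 1%N xk; rewrite add0n !addn1 => {1}<-.
  rewrite conjJg xk1 [x 1%N ^ _](_ : _ = x 2); last by rewrite x0.
  by have := shift _ _ 2 xk; rewrite add0n !addn2.
have xn : x n.+1 = b by rewrite /x cn1 conjg1.
(* As indices are periodic modulo [n.+1], the relation [x n.+1 ^ x 0 = x n.+2] now reads
   [b ^ b = b ^ c]. *)
have [] := xb n; rewrite xn x0 -[n.+2]add1n xD cn1 conjg1.
by rewrite [b ^ b]conjgE mulKg => /esym.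
Qed.

Variables (G : groupType) (b c : G).
Hypothesis (bcb : (b ^ c) ^ b = b ^ (c ^+ 2)).
Hypothesis (bc2b : (b ^ (c ^+ 2)) ^ b = b ^ (c ^+ 3)).
Hypothesis (bc_neq : b ^ c <> b).

Lemma infinite_of_thompson_relations : infinite_set [set: G]%classic.
Proof.
have cN n : c ^+ n.+1 <> 1.
  by move=> cn1; apply: bc_neq; exact: conjg_fixed_of_finite_order cn1.
have c_inj : injective (fun n => c ^+ n).
  move=> i j; wlog lt_ij : i j / (i < j)%N => [hw|] ij.
    by case: (ltngtP i j) => // lt; [|apply/esym]; exact: hw.
  exfalso; apply: (cN (j - i).-1); apply: (mulgI (c ^+ i)).
  by rewrite prednK ?subn_gt0// -expgnDr subnKC 1?ltnW// mulg1.
by move=> /(finite_preimage (in2W c_inj)); exact: infinite_nat.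
Qed.

Lemma not_LEF_of_thompson_relations : ~ LEF G.
Proof.
pose x k := b ^ (c ^+ k).
have xS k : x k ^ c = x k.+1 by rewrite /x expgSr conjgM.
have x0 : x 0 = b by rewrite /x conjg1.
(* Besides [c] and the [x k], the set holds one product [u * v] for each conjugation [u ^ v] to be
   transported. *)
pose s := [:: c; x 0; x 1%N; x 2; x 3; x 0 * c; x 1%N * c; x 2 * c;
              x 1%N * x 0; x 2 * x 0].
move=> /(_ [set` s]%classic (finite_seq s))[H [f [fM f_inj]]].
(* No inverses are needed in [s]: [u * v = v * u ^ v] factors one element of [s] in two ways. *)
have fJ u v : u \in s -> v \in s -> u ^ v \in s -> u * v \in s ->
    f (u ^ v) = f u ^ f v.
  move=> su sv suv sM; apply: (mulgI (f v)).
  by rewrite -fM ?/= -?conjgC // -fM // conjgC.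
have sc : c \in s by rewrite !inE eqxx.
have sx k : (k < 4)%N -> x k \in s.
  by case: k => [|[|[|[]]]]// _; rewrite !inE eqxx ?orbT.
have sxc k : (k < 3)%N -> x k * c \in s.
  by case: k => [|[|[]]]// _; rewrite !inE eqxx ?orbT.
have sxx k : (0 < k < 3)%N -> x k * x 0 \in s.
  by case: k => [|[|[]]]// _; rewrite !inE eqxx ?orbT.
have fx k : (k < 4)%N -> f (x k) = f b ^ (f c ^+ k).
  elim: k => [|k IHk] ltk; first by rewrite x0 conjg1.
  rewrite -xS fJ ?xS; [|exact/sx/ltnW|exact: sc|exact: sx|exact: sxc].
  by rewrite IHk 1?ltnW// expgSr conjgM.
have xJ k : (0 < k < 3)%N -> x k ^ x 0 = x k.+1.
  by case: k => [|[|[]]]// _; rewrite x0.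
have fxJ k : (0 < k < 3)%N -> (f b ^ (f c ^+ k)) ^ f b = f b ^ (f c ^+ k.+1).
  move=> /[dup] k03 /andP[k0 k3].
  rewrite -(fx _ (ltnW k3)) -(fx k.+1)// -[X in f _ ^ f X]x0.
  by rewrite -fJ ?xJ ?sx ?sxx// ltnW.
apply: bc_neq; rewrite -[in RHS]x0 -[b ^ c]/(x 1%N); apply: f_inj; rewrite ?inE /=.
- exact: sx.
- exact: sx.
(* The predecessor matches the exponent [n.+1] in the lemma. *)
rewrite !fx // conjg1; apply: (@conjg_fixed_of_finite_order _ _ _ #[f c].-1).
- exact: (fxJ 1%N).
- exact: fxJ.
- by rewrite prednK ?order_gt0// expg_order.
Qed.
End Groups.

(** * Increasing bijections of [[0, 1[] induce circle homeomorphisms *)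

Section CircleHomeomorphisms.
Local Open Scope ring_scope.
Variable R : realType.
Implicit Types (x y : R) (s t : Ico01 R) (g : bijection (Ico01 R)).

(** The inverse supplies the neighbourhoods: [f] pulls an open interval back to the open interval
    between the [h]-images of its endpoints. *)
Lemma increasing_cancel_continuous (f h : R -> R) :
  {homo f : x y / x < y} -> {homo h : x y / x < y} ->
  cancel f h -> cancel h f -> continuous f.
Proof.
move=> f_incr h_incr fK hK x; apply/cvgrPdist_lt => e e0.
have : x \in `]h (f x - e), h (f x + e)[.
  by rewrite in_itv/= -{2 3}(fK x) !h_incr// ?ltrBlDr ltrDl.
move=> /near_in_itvoo; apply: filterS => z; rewrite in_itv/= => /andP[].
by move=> /f_incr + /f_incr; rewrite !hK ltr_norml => *; lra.
Qed.

Lemma frac_subproof x : x - (Num.floor x)%:~R \in `[0, 1[.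
Proof.
by have := floor_itv x; rewrite in_itv/= intrD1 => /andP[*]; apply/andP; split; lra.
Qed.

(** Besides reducing modulo 1, this builds points of [Ico01] from real formulas without a proof of
    membership. *)
Definition frac x : Ico01 R := Sub (x - (Num.floor x)%:~R) (frac_subproof x).

Lemma Ico01_ge0 s : 0 <= val s.
Proof. by have := valP s; rewrite in_itv/= => /andP[]. Qed.

Lemma Ico01_lt1 s : val s < 1.
Proof. by have := valP s; rewrite in_itv/= => /andP[]. Qed.

Lemma floorDIco01 (n : int) s : Num.floor (n%:~R + val s) = n.
Proof.
by apply: floor_def; rewrite intrD1 lerDl ltrD2l Ico01_ge0 Ico01_lt1.
Qed.

Lemma fracDIco01 (n : int) s : frac (n%:~R + val s) = s.
Proof. by apply: val_inj; rewrite /= floorDIco01 addrAC subrr add0r. Qed.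

Lemma frac_id x : 0 <= x < 1 -> val (frac x) = x.
Proof. by move=> x01; rewrite /= (@floor_def _ x 0) ?subr0// add0r. Qed.

Lemma frac_val s : frac (val s) = s.
Proof. by rewrite -[RHS](fracDIco01 0) add0r. Qed.

Lemma frac_congr x y : congr_int x y -> frac x = frac y.
Proof.
move=> /intrP[n xy]; have -> : x = n%:~R + y by rewrite -xy subrK.
have -> : n%:~R + y = (n + Num.floor y)%:~R + val (frac y).
  by rewrite intrD /=; lra.
by rewrite fracDIco01.
Qed.

Lemma frac_repr x : frac (repr (\pi_(circle R) x)%qT) = frac x.
Proof. by apply: frac_congr; apply/eqmodP; rewrite reprK. Qed.

Lemma to_circle_frac x : to_circle (frac x) = (\pi_(circle R) x)%qT.
Proof.
apply/eqmodP; rewrite /= /congr_int /=.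
by rewrite addrAC subrr add0r rpredN intr_int.
Qed.

Definition increasing (f : Ico01 R -> Ico01 R) : Prop :=
  forall s t, val s < val t -> val (f s) < val (f t).

Lemma increasingV g : increasing g -> increasing (g^-1)%g.
Proof.
move=> g_incr s t; rewrite -{1}(bijection_invK g s) -{1}(bijection_invK g t).
set s' := bijection_inv g s; set t' := bijection_inv g t.
case: (ltgtP (val s') (val t')) => // [/g_incr|/val_inj ->].
  by move=> /lt_trans lt /lt; rewrite ltxx.
by rewrite ltxx.
Qed.

(** The lift to the universal cover of the circle, commuting with integer translations. *)
Definition lift_line (f : Ico01 R -> Ico01 R) x : R :=
  (Num.floor x)%:~R + val (f (frac x)).

Lemma lift_line_can (f h : Ico01 R -> Ico01 R) :
  cancel f h -> cancel (lift_line f) (lift_line h).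
Proof.
move=> fK x; rewrite /lift_line floorDIco01 fracDIco01 fK /=; lra.
Qed.

Lemma lift_line_increasing f :
  increasing f -> {homo lift_line f : x y / x < y}.
Proof.
move=> f_incr x y lt_xy; rewrite /lift_line.
have := le_floor (ltW lt_xy); rewrite le_eqVlt => /orP[/eqP fxy|].
  rewrite fxy ltrD2l; apply: f_incr; rewrite /= fxy; lra.
(* When the floors differ, an integer separates the two values. *)
rewrite -lezD1 -(ler_int R) intrD1 => lefxy.
have := Ico01_lt1 (f (frac x)); have := Ico01_ge0 (f (frac y)); lra.
Qed.

(** [repr q] is an arbitrary real representative, hence the [frac]. *)
Definition circle_map (f : Ico01 R -> Ico01 R) (q : circle R) : circle R :=
  to_circle (f (frac (repr q))).

Lemma circle_map_to_circle f s : circle_map f (to_circle s) = to_circle (f s).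
Proof. by rewrite /circle_map frac_repr frac_val. Qed.

Lemma circle_map_can f h : cancel f h -> cancel (circle_map f) (circle_map h).
Proof.
move=> fK q; rewrite {2}/circle_map circle_map_to_circle fK to_circle_frac.
exact: reprK.
Qed.

(** By the quotient topology, continuity can be tested after the projection from the line, where the
    map becomes the projection of [lift_line g]. *)
Lemma circle_map_continuous g : increasing g -> continuous (circle_map g).
Proof.
move=> g_incr; apply/quotient_continuous.
have -> : circle_map g \o \pi_(circle R)%qT
    = \pi_(circle R)%qT \o lift_line g.
  apply/funext => x /=; rewrite /circle_map frac_repr -[g (frac x)]frac_val.
  rewrite to_circle_frac; apply/eqmodP; rewrite /= /congr_int /lift_line.
  by rewrite opprD addrCA subrr addr0 rpredN intr_int.
move=> x; apply: continuous_comp; last exact: pi_continuous.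
apply: increasing_cancel_continuous.
- exact: lift_line_increasing.
- exact: lift_line_increasing (increasingV g_incr).
- exact/lift_line_can/bijection_funK.
- exact/lift_line_can/bijection_invK.
Qed.

Lemma increasing_induces_circle_homeomorphism g :
  increasing g -> induces_circle_homeomorphism g.
Proof.
move=> g_incr; exists (circle_map g); split; last exact: circle_map_to_circle.
split; first exact: circle_map_continuous.
exists (circle_map (g^-1)%g); split.
- exact/circle_map_continuous/increasingV.
- exact/circle_map_can/bijection_funK.
- exact/circle_map_can/bijection_invK.
Qed.
End CircleHomeomorphisms.

(** * Explicit piecewise dyadic maps and their intertwining relation *)

Section ThompsonElements.
Local Open Scope ring_scope.
Variable R : realType.
Implicit Types (x y : R) (s t : Ico01 R) (f g h : Ico01 R -> Ico01 R).

Lemma fracE x s : 0 <= x < 1 -> val s = x -> frac x = s.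
Proof. by move=> x01 <-; rewrite frac_val. Qed.

Definition contract s : Ico01 R := frac ((val s + 1) / 2).

Lemma val_contract s : val (contract s) = (val s + 1) / 2.
Proof. by apply: frac_id; have := Ico01_ge0 s; have := Ico01_lt1 s; lra. Qed.

(** On F this is the embedding onto the elements that fix the left half pointwise. *)
Definition half_copy f s : Ico01 R :=
  if val s < 2^-1 then s else contract (f (frac (2 * val s - 1))).

Variant half_spec s : bool -> R -> Type :=
| HalfLow of val s < 2^-1 : half_spec s true (val s)
| HalfHigh t of s = contract t : half_spec s false ((val t + 1) / 2).

Lemma halfP s : half_spec s (val s < 2^-1) (val s).
Proof.
have [lt|ge] := ltP (val s) 2^-1; first by constructor.
have vt : val (frac (2 * val s - 1)) = 2 * val s - 1.
  by apply: frac_id; have := Ico01_lt1 s; lra.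
have st : s = contract (frac (2 * val s - 1)).
  by apply: val_inj; rewrite val_contract vt; lra.
by rewrite {2}st val_contract; constructor.
Qed.

Lemma half_copy_low f s : val s < 2^-1 -> half_copy f s = s.
Proof. by rewrite /half_copy => ->. Qed.

Lemma half_copy_contract f s : half_copy f (contract s) = contract (f s).
Proof.
rewrite /half_copy val_contract ifF; last by have := Ico01_ge0 s; lra.
by congr (contract (f _)); apply: fracE; have := Ico01_ge0 s; have := Ico01_lt1 s; lra.
Qed.

Lemma half_copy_comp f g : half_copy f \o half_copy g =1 half_copy (f \o g).
Proof.
move=> s /=; case: (halfP s) => [lt|t ->]; first by rewrite !half_copy_low.
by rewrite !half_copy_contract.
Qed.

Lemma half_copy_can f g : cancel f g -> cancel (half_copy f) (half_copy g).
Proof.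
move=> fK s; case: (halfP s) => [lt|t ->]; first by rewrite !half_copy_low.
by rewrite !half_copy_contract fK.
Qed.

Lemma half_copy_increasing f : increasing f -> increasing (half_copy f).
Proof.
move=> f_incr s t; case: (halfP s) => [lts|s' ->]; case: (halfP t) => [ltt|t' ->].
- by rewrite !half_copy_low.
- rewrite half_copy_low// half_copy_contract val_contract => _.
  by have := Ico01_ge0 (f t'); lra.
- by have := Ico01_ge0 s'; lra.
- rewrite !half_copy_contract !val_contract => lt.
  suff : val (f s') < val (f t') by lra.
  by apply: f_incr; lra.
Qed.

Lemma dyadic_half x : dyadic x -> dyadic (x / 2).
Proof. by move=> /(dyadicMz (-1)); rewrite exprN1 mulrC. Qed.

Lemma half_copy_dyadic f : piecewise_dyadic f -> piecewise_dyadic (half_copy f).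
Proof.
move=> /piecewise_dyadicP[I [a [b [d [k [dI covI subI trivI fE]]]]]].
(* [None] is the left half; [Some i] is the rescaled piece [i]. Conjugation by [contract] keeps the
   slope [2 ^ k i] and changes only the translation. *)
apply/piecewise_dyadicP; exists (option I).
exists (oapp (fun i => (a i + 1) / 2) 0), (oapp (fun i => (b i + 1) / 2) 2^-1).
exists (oapp (fun i => (d i + 1 - 2 ^ k i) / 2) 0), (oapp k 0).
have inE i x : x \in `[(a i + 1) / 2, (b i + 1) / 2[ =
    (2 * x - 1 \in `[a i, b i[).
  by rewrite !in_itv/=; congr (_ && _); apply/idP/idP => ?; lra.
have ge0 i x : x \in `[a i, b i[ -> 0 <= x < 1.
  by move=> /subI; rewrite in_itv.
split=> [[i|]|x x01|[i|] x|[i|] [j|] x|[i|] x] /=.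
- have [da db dd] := dI i; split; apply: dyadic_half.
  + exact/dyadicD/dyadic1.
  + exact/dyadicD/dyadic1.
  + apply: dyadicD; first exact/dyadicD/dyadic1.
    by apply: dyadicN; rewrite -[2 ^ _]mulr1; exact/dyadicMz/dyadic1.
- by split; [exact: dyadic0|rewrite -div1r; exact/dyadic_half/dyadic1|exact: dyadic0].
- have [lt|ge] := ltP x 2^-1.
    by exists None; move: x01; rewrite /= !in_itv/= lt => /andP[->].
  have [|i xi] := covI (2 * x - 1); last by exists (Some i); rewrite inE.
  by move: x01; rewrite !in_itv/=; lra.
- by rewrite inE => /ge0; rewrite in_itv/=; lra.
- by rewrite !in_itv/=; lra.
- by rewrite !inE => xi xj; congr Some; exact: trivI xi xj.
- by rewrite inE => /ge0 ?; rewrite in_itv/= => ?; exfalso; lra.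
- by rewrite inE in_itv/= => ? /ge0 ?; exfalso; lra.
- by [].
- rewrite inE; case: (halfP x) => [lt /ge0|t ->]; first by lra.
  rewrite half_copy_contract val_contract.
  rewrite [2 * _ - 1](_ : _ = val t); last by lra.
  by move=> /fE ->; field.
- by rewrite in_itv/= => /andP[_ lt]; rewrite expr0z mul1r addr0 half_copy_low.
Qed.

(* The standard first generator of Thompson's group F. *)
Definition expand s : Ico01 R :=
  frac (if val s < 2^-1 then val s / 2
        else if val s < 3 / 4 then val s - 4^-1 else 2 * val s - 1).

Definition expandV s : Ico01 R :=
  frac (if val s < 4^-1 then 2 * val s
        else if val s < 2^-1 then val s + 4^-1 else (val s + 1) / 2).

Lemma val_expand s : val (expand s) =
  if val s < 2^-1 then val s / 2
  else if val s < 3 / 4 then val s - 4^-1 else 2 * val s - 1.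
Proof.
apply: frac_id; have := Ico01_ge0 s; have := Ico01_lt1 s.
by do ?case: ifP => ?; lra.
Qed.

Lemma val_expandV s : val (expandV s) =
  if val s < 4^-1 then 2 * val s
  else if val s < 2^-1 then val s + 4^-1 else (val s + 1) / 2.
Proof.
apply: frac_id; have := Ico01_ge0 s; have := Ico01_lt1 s.
by do ?case: ifP => ?; lra.
Qed.

Variant expand_spec s : R -> Type :=
| ExpandLow of val s < 2^-1 : expand_spec s (val s / 2)
| ExpandMiddle of 2^-1 <= val s & val s < 3 / 4 : expand_spec s (val s - 4^-1)
| ExpandHigh of 3 / 4 <= val s : expand_spec s (2 * val s - 1).

Lemma expandP s : expand_spec s (val (expand s)).
Proof.
rewrite val_expand; have [?|?] := ltP (val s) 2^-1; first by constructor.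
by have [?|?] := ltP (val s) (3 / 4); constructor.
Qed.

Lemma expandK : cancel expand expandV.
Proof.
move=> s; apply: val_inj; rewrite val_expandV.
by case: expandP => *; do ?case: ifP => ?; lra.
Qed.

Lemma expandVK : cancel expandV expand.
Proof.
move=> s; apply: val_inj; move: (val_expandV s).
by case: expandP; do ?case: ifP => ?; lra.
Qed.

Lemma expand_increasing : increasing expand.
Proof. by move=> s t; case: expandP => *; case: expandP => *; lra. Qed.

Lemma expand_dyadic : piecewise_dyadic expand.
Proof.
have d1 := dyadic1 R; have d0 := dyadic0 R.
have d2 : dyadic (2^-1 : R) by rewrite -div1r; exact: dyadic_half.
have d4 : dyadic (4^-1 : R).
  by rewrite [4^-1](_ : _ = 2^-1 / 2); [exact: dyadic_half | lra].
have d3 : dyadic (3 / 4 : R).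
  by rewrite [3 / 4](_ : _ = 2^-1 + 4^-1); [exact: dyadicD | lra].
(* From left to right the pieces are [Some false], [Some true], [None]. *)
apply/piecewise_dyadicP; exists (option bool).
exists (oapp (fun i : bool => if i then 2^-1 else 0) (3 / 4)).
exists (oapp (fun i : bool => if i then 3 / 4 else 2^-1) 1).
exists (oapp (fun i : bool => if i then - 4^-1 else 0) (- 1)).
exists (oapp (fun i : bool => if i then 0 else -1) 1).
split=> [i|x|i x|i j x|i x].
- by case: i => [[]|]; split=> //; exact: dyadicN.
- rewrite in_itv/= => x01.
  have [?|?] := ltP x 2^-1; first by exists (Some false); rewrite in_itv/=; lra.
  have [?|?] := ltP x (3 / 4); first by exists (Some true); rewrite in_itv/=; lra.
  by exists None; rewrite in_itv/=; lra.
- by case: i => [[]|]; rewrite !in_itv/=; lra.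
- by case: i j => [[]|] [[]|] //; rewrite !in_itv/= => ? ?; exfalso; lra.
- by case: expandP; case: i => [[]|]; rewrite in_itv/= ?expr0z ?expr1z ?exprN1; lra.
Qed.

Lemma expand_contract s : 2^-1 <= val s -> expand (contract s) = s.
Proof.
move=> ge; apply: val_inj; move: (val_contract s).
by case: expandP; lra.
Qed.

(** [expand] maps [[3/4, 1[] onto the right half by the inverse of [contract], which carries one
    copy of [f] to the other. It maps [[0, 3/4[] onto the left half, and there both copies act
    trivially. *)
Lemma expand_half_copy f :
  expand \o half_copy (half_copy f) =1 half_copy f \o expand.
Proof.
move=> s /=; case: (halfP s) => [lt|t ->].
  rewrite !half_copy_low// val_expand lt; have := Ico01_ge0 s; lra.
rewrite half_copy_contract; case: (halfP t) => [lt|u ->].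
  rewrite !half_copy_low//; move: (val_contract t).
  by case: expandP; have := Ico01_ge0 t; lra.
by rewrite !half_copy_contract !expand_contract ?half_copy_contract// val_contract;
  [have := Ico01_ge0 u | have := Ico01_ge0 (f u)]; lra.
Qed.
End ThompsonElements.

(** * The relations in T, and the passage to V *)

Section ThompsonT.
Local Open Scope ring_scope.
Variable R : realType.

(** The elements of Thompson's group F; their products are taken in [thompsonT]. *)
Record increasing_dyadic := IncreasingDyadic {
  id_fun :> bijection (Ico01 R);
  id_increasing : increasing id_fun;
  id_dyadic : piecewise_dyadic id_fun }.
Implicit Types f g h k : increasing_dyadic.

Definition toV f : thompsonV R := Sub (f : bijection _) (asboolT (id_dyadic f)).

Definition toT f : thompsonT R :=
  Sub (toV f) (asboolT (increasing_induces_circle_homeomorphism (id_increasing f))).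

Lemma toT_mul f g h k : f \o g =1 h \o k ->
  (toT f * toT g = toT h * toT k)%g.
Proof. by move=> fghk; do 2!apply: val_inj; exact: bijection_eq. Qed.

(** The intertwining form avoids computing with inverse maps. *)
Lemma toT_conj f g h : g \o h =1 f \o g -> (toT f ^ toT g = toT h)%g.
Proof. by move=> /toT_mul gh; rewrite conjgE -gh mulKg. Qed.

Definition expandT : increasing_dyadic :=
  @IncreasingDyadic (Bijection (Bijective (@expandK R) (@expandVK R)))
    (@expand_increasing R) (@expand_dyadic R).

Lemma half_copy_bij (f : bijection (Ico01 R)) : bijective (half_copy f).
Proof.
by exists (half_copy (f^-1)%g); apply: half_copy_can;
  [exact: bijection_funK | exact: bijection_invK].
Qed.

Definition half_copyT f : increasing_dyadic :=
  @IncreasingDyadic (Bijection (half_copy_bij f))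
    (half_copy_increasing (id_increasing f)) (half_copy_dyadic (id_dyadic f)).

(* The conjugate [x_n] of [x_0 = half_copy expand] by the nth power of [expand]. *)
Definition conjT n : increasing_dyadic := iter n.+1 half_copyT expandT.

Lemma conjT_expandT n :
  (toT (conjT 0) ^ (toT expandT ^+ n) = toT (conjT n))%g.
Proof.
elim: n => [|n IHn]; first by rewrite conjg1.
rewrite expgSr conjgM IHn; apply: toT_conj; exact: expand_half_copy.
Qed.

(** Since [half_copy] is multiplicative, it sends the relation for conjugation by [expand] to one
    for conjugation by [half_copy expand]. *)
Lemma conjT_conjT0 n :
  (toT (conjT n.+1) ^ toT (conjT 0) = toT (conjT n.+2))%g.
Proof.
apply: toT_conj => s; rewrite [LHS]half_copy_comp [RHS]half_copy_comp.
by congr half_copy; apply/funext; exact: expand_half_copy.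
Qed.

Lemma conjT1_neq : toT (conjT 1) <> toT (conjT 0).
Proof.
move=> /(congr1 (fun u : thompsonT R => val (val u))) /= eq_conj.
(* The test point is [contract s], that is 5/8: [conjT 1] moves only points of [[3/4, 1[], while
   [conjT 0] sends 5/8 to 9/16. *)
pose s : Ico01 R := frac 4^-1.
have vs : val s = 4^-1 by rewrite frac_id//; lra.
have := congr1 (fun f : bijection (Ico01 R) => val (f (contract s))) eq_conj.
rewrite [X in X = _](_ : _ = val (contract s)); last first.
  by congr val; rewrite [LHS]half_copy_contract half_copy_low// vs; lra.
rewrite [X in _ = X](_ : _ = val (contract (expand s))); last first.
  by congr val; rewrite [LHS]half_copy_contract.
by rewrite !val_contract; case: expandP; lra.
Qed.

Lemma thompson_relation n :
  ((toT (conjT 0) ^ (toT expandT ^+ n.+1)) ^ toT (conjT 0)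
   = toT (conjT 0) ^ (toT expandT ^+ n.+2))%g.
Proof. by rewrite !conjT_expandT conjT_conjT0. Qed.

Lemma conjT_expandT_neq :
  (toT (conjT 0) ^ toT expandT)%g <> toT (conjT 0).
Proof. rewrite (conjT_expandT 1); exact: conjT1_neq. Qed.

Lemma infinite_thompsonT : infinite_set [set: thompsonT R]%classic.
Proof.
exact: infinite_of_thompson_relations (thompson_relation 0)
  (thompson_relation 1) conjT_expandT_neq.
Qed.

Lemma thompsonT_not_LEF : ~ LEF (thompsonT R).
Proof.
exact: not_LEF_of_thompson_relations (thompson_relation 0)
  (thompson_relation 1) conjT_expandT_neq.
Qed.

(** LEF passes to subgroups: a local embedding of the image of [A] in V restricts to one of [A]. *)
Lemma thompsonV_not_LEF : ~ LEF (thompsonV R).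
Proof.
move=> LEF_V; apply: thompsonT_not_LEF => A fin_A.
have [H [f [fM f_inj]]] := LEF_V _ (finite_image val fin_A).
exists H, (f \o val); split=> [u v Au Av Auv|u v /set_mem Au /set_mem Av fuv].
  by rewrite /= -fM //; [exists u | exists v | exists (u * v)%g].
by apply/val_inj/f_inj => //; rewrite inE; [exists u | exists v].
Qed.
End ThompsonT.

Theorem theorem3 :
  (exists G : groupType, infinite_set [set: G]%classic /\ ~ LEF G) /\
  (forall R : realType, ~ LEF (thompsonT R) /\ ~ LEF (thompsonV R)).
Proof.
split=> [|R]; last by split; [exact: thompsonT_not_LEF | exact: thompsonV_not_LEF].
(* The existential claim requires a concrete model of the reals. *)
exists (thompsonT Rdefinitions.R).
by split; [exact: infinite_thompsonT | exact: thompsonT_not_LEF].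
Qed.
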